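(* For any function $f:X\to Y$, the map $\mathrm{Path}_\sim f:\mathrm{Path}_\sim(X)\to\mathrm{Path}_\sim(Y)$, $[p]_\sim\mapsto[f\circ p]_\sim$, is order preserving. Consequently it is Borel measurable, where both spaces carry the Borel $\sigma$-algebras of their Alexandroff topologies.
   Context: Fix a set $A$, $\tau\notin A$, $A_\tau=A\cup\{\tau\}$, $A_\tau^*$ the finite words, $\epsilon$ the empty word, ${\downarrow}\sigma$ the set of prefixes of $\sigma$. A path on $X$ is a function $p$ into $X$ with domain ${\downarrow}\sigma$ for some $\sigma\in A_\tau^*$; paths are ordered by $p\preceq q$ iff $\mathrm{dom}\,p\subseteq\mathrm{dom}\,q$ and $q$ agrees with $p$ on $\mathrm{dom}\,p$. The stutter basis of $p$ is the unique $\phi:\mathrm{dom}\,p\to A_\tau^*$ with $\phi(\epsilon)=\epsilon$; $\phi(\sigma'\tau)=\phi(\sigma')$ if $p(\sigma'\tau)=p(\sigma')$; $\phi(\sigma'\tau)=\phi(\sigma')\tau$ if $p(\sigma'\tau)\ne p(\sigma')$; $\phi(\sigma'a)=\phi(\sigma')a$ for $a\in A$. $\mathrm{st}(p)$ is the path with domain $\phi(\mathrm{dom}\,p)$ with $\mathrm{st}(p)\circ\phi=p$; $p\sim q$ iff $\mathrm{st}(p)=\mathrm{st}(q)$; $\mathrm{Path}_\sim(X)=\mathrm{Path}(X)/{\sim}$, ordered by $[p]\preceq[q]$ iff $\mathrm{st}(p)\preceq\mathrm{st}(q)$. The Alexandroff topology of a poset has as open sets the upward closed subsets. *)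

(* Defs.v *)
From HB Require Import structures.
From mathcomp Require Import all_boot all_order.
From mathcomp Require Import generic_quotient.
From mathcomp Require Import boolp classical_sets topology measure.

Set Implicit Arguments.
Unset Strict Implicit.
Unset Printing Implicit Defensive.

Import Order.TTheory.
Local Open Scope quotient_scope.
Local Open Scope classical_set_scope.

(* The action [None] is tau and [Some a] is [a]; a word grows on its right,
   so that sigma followed by an action x is [rcons sigma x]. *)
Definition word (A : Type) := seq (option A).

(* [seq.prefix] would require decidable equality on [A]. *)
Definition down (A : Type) (s : word A) : set (word A) :=
  [set w | exists t, s = w ++ t].

Section Paths.
Context {A X : Type}.

Definition dom (f : word A -> option X) : set (word A) := [set w | isSome (f w)].

(* A function defined on a set of words is a partial function on words, whose
   value is [None] outside of the set. *)
Record Path := MkPath {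
  path_fun :> word A -> option X;
  path_dom : exists s, dom path_fun = down s }.

Definition Path_le (p q : Path) : Prop :=
  dom p `<=` dom q /\ forall w, dom p w -> q w = p w.

Definition is_stutter_basis (p : Path) (phi : word A -> word A) : Prop :=
  phi [::] = [::] /\
  forall w x, dom p (rcons w x) ->
    phi (rcons w x) =
      match x with
      | None => if `[< p (rcons w None) = p w >] then phi w
                else rcons (phi w) None
      | Some a => rcons (phi w) (Some a)
      end.

(* Computes the stutter basis at [rev r]. *)
Fixpoint stutter_rev (p : Path) (r : word A) : word A :=
  match r with
  | [::] => [::]
  | None :: r' => if `[< p (rev r) = p (rev r') >] then stutter_rev p r'
                  else rcons (stutter_rev p r') None
  | Some a :: r' => rcons (stutter_rev p r') (Some a)
  end.

(* Only meaningful on [dom p]. *)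
Definition stutter_basis (p : Path) (w : word A) : word A := stutter_rev p (rev w).

Lemma stutter_basis_rcons (p : Path) w x :
  stutter_basis p (rcons w x) =
    match x with
    | None => if `[< p (rcons w None) = p w >] then stutter_basis p w
              else rcons (stutter_basis p w) None
    | Some a => rcons (stutter_basis p w) (Some a)
    end.
Proof.
by rewrite /stutter_basis rev_rcons; case: x => [a|] //=; rewrite rev_cons revK.
Qed.

Lemma stutter_basisP (p : Path) : is_stutter_basis p (stutter_basis p).
Proof. by split=> // w x _; rewrite stutter_basis_rcons. Qed.

Lemma dom_cat (p : Path) w t : dom p (w ++ t) -> dom p w.
Proof.
by have [s ->] := path_dom p; case=> u ->; exists (t ++ u); rewrite catA.
Qed.

Lemma stutter_basis_unique (p : Path) phi : is_stutter_basis p phi ->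
  forall w, dom p w -> phi w = stutter_basis p w.
Proof.
move=> [phi0 phiS]; elim/last_ind => [|w x IH] // dwx.
rewrite phiS // stutter_basis_rcons IH //.
by move: dwx; rewrite -cats1; exact: dom_cat.
Qed.

Lemma path_ext (p q : Path) : path_fun p =1 path_fun q -> p = q.
Proof.
case: p q => [p hp] [q hq] /= /funext pq.
by subst q; congr MkPath; exact: Prop_irrelevance.
Qed.

Lemma stutter_basis_cat (p : Path) w t :
  exists u, stutter_basis p (w ++ t) = stutter_basis p w ++ u.
Proof.
elim/last_ind: t => [|t x [u IH]]; first by exists [::]; rewrite !cats0.
rewrite -rcons_cat stutter_basis_rcons IH.
case: x => [a|]; first by exists (rcons u (Some a)); rewrite rcons_cat.
by case: ifP => _; [exists u | exists (rcons u None); rewrite rcons_cat].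
Qed.

Lemma stutter_basis_cat_inj (p : Path) w t :
  stutter_basis p (w ++ t) = stutter_basis p w -> p (w ++ t) = p w.
Proof.
elim/last_ind: t => [|t x IH]; first by rewrite cats0.
rewrite -rcons_cat stutter_basis_rcons.
have [u uE] := stutter_basis_cat p w t.
have absurd y : rcons (stutter_basis p (w ++ t)) y <> stutter_basis p w.
  rewrite uE => /(congr1 size); rewrite size_rcons size_cat => /eqP.
  by rewrite -addnS -[X in _ == X]addn0 eqn_add2l.
case: x => [a /absurd //|]; case: ifPn => [/asboolP e /IH <- //|_ /absurd //].
Qed.

Lemma stutter_basis_inj (p : Path) w w' : dom p w -> dom p w' ->
  stutter_basis p w = stutter_basis p w' -> p w = p w'.
Proof.
have [s ->] := path_dom p; case=> t st [t' st'].
wlog le_ww' : w w' t t' st st' / size w <= size w'.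
  move=> H; case/orP: (leq_total (size w) (size w')); first exact: (H w w' t t').
  by move=> le /esym e; apply/esym; exact: (H w' w t' t).
have -> : w' = w ++ drop (size w) w'.
  have := congr1 (take (size w')) st'; rewrite take_size_cat // st.
  rewrite take_cat ltnNge le_ww' /= => {2}<-.
  by rewrite drop_size_cat // -[LHS](take_size_cat t' (erefl (size w'))) -st' st
             take_cat ltnNge le_ww'.
by move=> /esym/stutter_basis_cat_inj.
Qed.

(* st(p) sends phi(w) to p(w), for w in the domain of p. *)
Definition st_fun (p : Path) (v : word A) : option X :=
  match pselect (exists w, dom p w /\ stutter_basis p w = v) with
  | left H => p (projT1 (cid H))
  | right _ => None
  end.

Lemma st_funE (p : Path) w : dom p w -> st_fun p (stutter_basis p w) = p w.
Proof.
move=> dw; rewrite /st_fun; case: pselect => [H|]; last by case; exists w.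
by case: (cid H) => w' /= [dw' e]; exact: stutter_basis_inj.
Qed.

Lemma dom_st_fun (p : Path) : dom (st_fun p) = stutter_basis p @` dom p.
Proof.
apply/seteqP; split=> [v|_ [w dw <-]]; last by rewrite /dom /= st_funE.
rewrite /dom /= /st_fun; case: pselect => // H _.
by case: H => w [dw e]; exists w.
Qed.

Lemma stutter_basis_down (p : Path) s :
  stutter_basis p @` down s = down (stutter_basis p s).
Proof.
apply/seteqP; split=> [_ [w [t ->] <-]|v].
  by have [u ->] := stutter_basis_cat p w t; exists u.
elim/last_ind: s v => [|s x IH] v.
  by case=> t e; exists [::]; [exists [::]|case: v e].
have lift : down (stutter_basis p s) v -> (stutter_basis p @` down (rcons s x)) v.
  by move/IH => [w [t ->] <-]; exists w => //; exists (rcons t x); rewrite rcons_cat.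
have last y : stutter_basis p (rcons s x) = rcons (stutter_basis p s) y ->
    down (rcons (stutter_basis p s) y) v ->
    (stutter_basis p @` down (rcons s x)) v.
  move=> e [t]; case/lastP: t => [|t z].
    rewrite cats0 => <-; exists (rcons s x) => //.
    by exists [::]; rewrite cats0.
  by rewrite -rcons_cat => /rcons_inj [tE _]; apply: lift; exists t.
move: (last); rewrite stutter_basis_rcons; case: x {last} lift => [a|] lift last.
  exact: last.
by move: last; case: ifP => // _ last; exact: last.
Qed.

Lemma st_dom (p : Path) : exists s, dom (st_fun p) = down s.
Proof.
have [s ps] := path_dom p; exists (stutter_basis p s).
by rewrite dom_st_fun ps stutter_basis_down.
Qed.

Definition st (p : Path) : Path := MkPath (st_dom p).

Lemma stP (p : Path) : dom (st p) = stutter_basis p @` dom p /\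
  forall w, dom p w -> st p (stutter_basis p w) = p w.
Proof. by split; [exact: dom_st_fun|exact: st_funE]. Qed.

Lemma st_unique (p q : Path) : dom q = stutter_basis p @` dom p ->
  (forall w, dom p w -> q (stutter_basis p w) = p w) -> q = st p.
Proof.
move=> dq qE; apply: path_ext => v; have [ds sE] := stP p.
have [[w dw <-]|nv] := pselect ((stutter_basis p @` dom p) v).
  by rewrite qE // sE.
have none (r : Path) : dom r = stutter_basis p @` dom p -> r v = None.
  move=> dr; move: nv; rewrite -dr /dom /=.
  by case: (path_fun r v) => // x; case.
by rewrite !none.
Qed.

HB.instance Definition _ := gen_eqMixin Path.
HB.instance Definition _ := gen_choiceMixin Path.

Definition sim : rel Path := fun p q => st p == st q.

Lemma sim_equiv : equiv_class_of sim.
Proof.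
by split=> [p|p q|q p r]; rewrite /sim // => /eqP ->.
Qed.

Canonical sim_equivRel := EquivRelPack sim_equiv.

Lemma Path_le_refl p : Path_le p p.
Proof. by split. Qed.

Lemma Path_le_anti p q : Path_le p q -> Path_le q p -> p = q.
Proof.
move=> [dpq pq] [dqp qp]; apply: path_ext => w.
have [/pq ->//|np] := pselect (dom p w).
have nq : ~ dom q w by move/dqp.
by move: np nq; rewrite /dom /=; case: (p w) => [x []|] //; case: (q w) => // x _ [].
Qed.

Lemma Path_le_trans q p r : Path_le p q -> Path_le q r -> Path_le p r.
Proof.
move=> [dpq pq] [dqr qr]; split=> [w /dpq/dqr//|w dw].
by rewrite qr ?pq//; exact: dpq.
Qed.

End Paths.
Arguments Path A X : clear implicits.

Definition PathSim (A X : Type) := {eq_quot (@sim A X)}.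

HB.instance Definition _ (A X : Type) := Choice.on (PathSim A X).
HB.instance Definition _ (A X : Type) := Quotient.on (PathSim A X).

Definition cls {A X : Type} (p : Path A X) : PathSim A X := \pi_(PathSim A X) p.

Section PathSimOrder.
Context {A X : Type}.
Implicit Types u v : PathSim A X.

Lemma cls_eq (p q : Path A X) : cls p = cls q <-> st p = st q.
Proof. by split=> [/eqmodP/eqP|pq]; [|apply/eqmodP/eqP]. Qed.

Lemma st_repr (p : Path A X) : st (repr (cls p)) = st p.
Proof. by apply/cls_eq; rewrite /cls reprK. Qed.

Definition sim_le u v : bool := `[< Path_le (st (repr u)) (st (repr v)) >].

Lemma sim_le_refl : reflexive sim_le.
Proof. by move=> u; apply/asboolP; exact: Path_le_refl. Qed.

Lemma sim_le_anti : antisymmetric sim_le.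
Proof.
move=> u v /andP[/asboolP uv /asboolP vu].
rewrite -(reprK u) -(reprK v); apply/cls_eq; exact: Path_le_anti.
Qed.

Lemma sim_le_trans : transitive sim_le.
Proof.
by move=> v u w /asboolP uv /asboolP vw; apply/asboolP; exact: Path_le_trans vw.
Qed.

End PathSimOrder.

HB.instance Definition _ (A X : Type) :=
  Order.Le_isPOrder.Build (Order.Disp tt tt) (PathSim A X)
    (@sim_le_refl A X) (@sim_le_anti A X) (@sim_le_trans A X).

Lemma cls_le (A X : Type) (p q : Path A X) :
  (cls p <= cls q)%O <-> Path_le (st p) (st q).
Proof.
have -> : (cls p <= cls q)%O = sim_le (cls p) (cls q) by [].
by rewrite /sim_le !st_repr; split=> /asboolP.
Qed.

Section Functoriality.
Context {A X Y : Type}.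
Variable f : X -> Y.

Lemma path_comp_dom (p : Path A X) : exists s, dom (fun w => omap f (p w)) = down s.
Proof.
have [s ps] := path_dom p; exists s; rewrite -ps.
by apply/seteqP; split=> w; rewrite /dom /=; case: (path_fun p w).
Qed.

Definition path_comp (p : Path A X) : Path A Y := MkPath (path_comp_dom p).

(* Defined on representatives; that it maps the class of every [p] to the class
   of [path_comp p] has to be proved. *)
Definition pathsim_map (u : PathSim A X) : PathSim A Y := cls (path_comp (repr u)).

End Functoriality.

Definition up_closed {d} {T : porderType d} (U : set T) : Prop :=
  forall x y, U x -> (x <= y)%O -> U y.

Definition alexandroff {d} (T : porderType d) : Type := T.

Section Alexandroff.
Context {d : Order.disp_t} {T : porderType d}.

HB.instance Definition _ := Choice.copy (alexandroff T) T.

Lemma up_closedT : up_closed [set: T].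
Proof. by []. Qed.

Lemma up_closedI : setI_closed (@up_closed d T).
Proof. by move=> U V hU hV x y [Ux Vx] xy; split; [exact: hU xy|exact: hV xy]. Qed.

Lemma up_closed_bigcup (I : Type) (F : I -> set T) :
  (forall i, up_closed (F i)) -> up_closed (\bigcup_i F i).
Proof. by move=> hF x y [i _ Fx] xy; exists i => //; exact: hF xy. Qed.

HB.instance Definition _ := isOpenTopological.Build (alexandroff T)
  up_closedT up_closedI up_closed_bigcup.

Lemma alexandroff_openE : @open (alexandroff T) = @up_closed d T.
Proof. by []. Qed.

End Alexandroff.

Definition borel (T : topologicalType) : set (set T) := <<s @open T >>.

(* Measurability for the Borel sigma-algebras: the library's [measurable_fun] is
   not used since its types are pointed, while a path space may be empty. *)
Definition borel_measurable (T U : topologicalType) (g : T -> U) : Prop :=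
  forall B : set U, borel B -> borel (g @^-1` B).

(* Main.v *)
(* The map st sends p to its values at the non-stuttering steps, and
   st (f o p) = st (f o st p), because the steps at which p stutters are also
   steps at which f o p does.  Hence the class of f o p depends monotonically on
   st p, since f o - and st both preserve the prefix order.  Monotone maps are
   continuous for Alexandroff topologies, and continuous maps are Borel. *)

Require Import Defs.
From mathcomp Require Import all_boot all_order.
From mathcomp Require Import boolp classical_sets topology measure.

Local Open Scope classical_set_scope.

Section PathOrder.
Context {A X : Type}.
Implicit Types p q : Path A X.

Lemma dom_rcons p w x : dom p (rcons w x) -> dom p w.
Proof. by rewrite -cats1; exact: dom_cat. Qed.

(** The basis at [w] depends only on the values at prefixes of [w]; these lie in [dom p], where [q]
    agrees with [p]. *)
Lemma stutter_basis_le p q w :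
  Path_le p q -> dom p w -> stutter_basis q w = stutter_basis p w.
Proof.
case=> _ pq; elim/last_ind: w => [//|w x IH] dwx.
have dw := dom_rcons _ _ _ dwx.
rewrite !stutter_basis_rcons IH //.
by case: x dwx => [//|] dwx; rewrite !pq.
Qed.

Lemma st_le p q : Path_le p q -> Path_le (st p) (st q).
Proof.
move=> le_pq; have [dpq pq] := le_pq.
have [dp pE] := stP p; have [dq qE] := stP q.
split=> [v|v]; rewrite dp => -[w dw <-]; rewrite -(stutter_basis_le _ _ _ le_pq dw).
  by rewrite dq; exists w => //; exact: dpq.
by rewrite qE ?pq ?(stutter_basis_le _ _ _ le_pq dw) ?pE//; exact: dpq.
Qed.

End PathOrder.

Section PathMaps.
Context {A X Y : Type}.
Variable f : X -> Y.
Implicit Types p q : Path A X.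

Lemma dom_path_comp p : dom (path_comp f p) = dom p.
Proof. by apply/seteqP; split=> w; rewrite /dom /=; case: (path_fun p w). Qed.

Lemma path_comp_le p q : Path_le p q -> Path_le (path_comp f p) (path_comp f q).
Proof.
case=> dpq pq; split=> [w|w]; rewrite !dom_path_comp; first exact: dpq.
by move=> dw /=; rewrite pq.
Qed.

(** A tau-step where [p] stutters is a stutter of f o p too and changes neither side. At any other
    tau-step [st p] takes the values of [p] at both ends, so f o st p stutters there exactly when f
    o p does. *)
Lemma stutter_basis_path_comp_st p w : dom p w ->
  stutter_basis (path_comp f (st p)) (stutter_basis p w) =
  stutter_basis (path_comp f p) w.
Proof.
elim/last_ind: w => [//|w x IH] dwx; have dw := dom_rcons _ _ _ dwx.
case: x dwx => [a|] dwx; first by rewrite !stutter_basis_rcons IH.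
have [e|ne] := pselect (p (rcons w None) = p w).
  rewrite !stutter_basis_rcons asboolT //= asboolT ?IH //.
  by rewrite /= e.
have sE : stutter_basis p (rcons w None) = rcons (stutter_basis p w) None.
  by rewrite stutter_basis_rcons asboolF.
(* Folding back with [sE] lets [st_funE] evaluate [st p] at both ends of the step. *)
rewrite sE !stutter_basis_rcons IH // -sE.
by rewrite /= !st_funE.
Qed.

(** The bases of [p] and of f o st p compose to that of f o p, so [st_unique] applies. *)
Lemma st_path_comp_st p : st (path_comp f (st p)) = st (path_comp f p).
Proof.
have [dp _] := stP p; have [dfp fpE] := stP (path_comp f (st p)).
apply: st_unique => [|w]; rewrite dom_path_comp.
  rewrite dfp dom_path_comp dp (image_comp (stutter_basis p)).
  by apply: eq_imagel => w; exact: stutter_basis_path_comp_st.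
move=> dw; rewrite -stutter_basis_path_comp_st // fpE ?dom_path_comp ?dp /= ?st_funE //.
by exists w.
Qed.

(** The chosen representative has the same [st] as [p], and [st p] alone determines the class of f o
    p. *)
Lemma pathsim_map_cls p : pathsim_map f (cls p) = cls (path_comp f p).
Proof. by apply/cls_eq; rewrite -st_path_comp_st st_repr st_path_comp_st. Qed.

Lemma pathsim_map_le (u v : PathSim A X) :
  (u <= v)%O -> (pathsim_map f u <= pathsim_map f v)%O.
Proof.
move=> /asboolP le_uv; apply/cls_le.
(* The order on classes compares the [st] of representatives, so both sides are expressed through
   these. *)
rewrite -(st_path_comp_st (repr u)) -(st_path_comp_st (repr v)).
exact/st_le/path_comp_le.
Qed.

End PathMaps.

Lemma monotone_alexandroff_continuous {d d'} {T : porderType d}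
    {U : porderType d'} (g : T -> U) :
  (forall x y, (x <= y)%O -> (g x <= g y)%O) ->
  continuous (g : alexandroff T -> alexandroff U).
Proof.
move=> g_le; apply/continuousP => B; rewrite !alexandroff_openE => upB x y Bgx xy.
exact: upB Bgx (g_le _ _ xy).
Qed.

Lemma continuous_borel_measurable {T U : topologicalType} (g : T -> U) :
  continuous g -> borel_measurable g.
Proof.
move=> /continuousP g_cont B borelB.
(* The sets with Borel preimage form a sigma-algebra, which contains the open sets by continuity. *)
suff : image_set_system setT g (@borel T) B by rewrite /image_set_system /= setTI.
apply: smallest_sub B borelB.
  exact/sigma_algebra_image/smallest_sigma_algebra.
move=> C oC; rewrite /image_set_system /= setTI.
by apply: sub_sigma_algebra; exact: g_cont.
Qed.

Theorem theorem28 (A X Y : Type) (f : X -> Y) :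
  (forall p : Path A X, pathsim_map f (cls p) = cls (path_comp f p)) /\
  (forall u v : PathSim A X,
     (u <= v)%O -> (pathsim_map f u <= pathsim_map f v)%O) /\
  @borel_measurable (alexandroff (PathSim A X)) (alexandroff (PathSim A Y))
    (pathsim_map f).
Proof.
split; first exact: pathsim_map_cls.
split; first exact: pathsim_map_le.
apply: continuous_borel_measurable.
apply: (@monotone_alexandroff_continuous _ _ (PathSim A X) (PathSim A Y)).
exact: pathsim_map_le.
Qed.
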